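(* Let $b \geq 2$ be an integer, let $A=\{0,\dots,b-1\}$, and let $P=\{p_1,\dots,p_r\}$ be a finite set of $r\ge 1$ primes. Let $T_P \subseteq A^\omega$ be the set of all sequences $t_1t_2t_3\cdots$ over $A$ such that $t_n = t_{np_i}$ for every $n\ge 1$ and every $i=1,\dots,r$. Let $\tau_P: A^\omega\to A^\omega$ be the Toeplitz transform and let $\mu$ be the push-forward under $\tau_P$ of the uniform product probability measure $\lambda$ on $A^\omega$ (both defined in the context). Then $\mu$-almost every element of $T_P$ is the base-$b$ expansion of a real number that is normal to base $b$.
   Context: Let $j_1<j_2<j_3<\cdots$ be the increasing enumeration of all positive integers divisible by none of $p_1,\dots,p_r$. Every positive integer $n$ has a unique decomposition $n=j_k p_1^{e_1}\cdots p_r^{e_r}$ with $e_i\ge 0$. The Toeplitz transform is $\tau_P(a_1a_2a_3\cdots)=t_1t_2t_3\cdots$ where $t_n=a_k$ when $n=j_kp_1^{e_1}\cdots p_r^{e_r}$; its image is $T_P$. $\lambda$ is the infinite product of the uniform measure on $A$, and $\mu(X)=\lambda(\tau_P^{-1}(X))$ for measurable $X\subseteq T_P$. A sequence $a_1a_2\cdots\in A^\omega$ is identified with the real number $\sum_{j\ge1}a_jb^{-j}$ (its base-$b$ expansion). A real number is simply normal to base $b$ if each digit in $\{0,\dots,b-1\}$ occurs in its base-$b$ expansion with asymptotic frequency $1/b$; it is normal to base $b$ if it is simply normal to each of the bases $b,b^2,b^3,\dots$. *)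

(* Defs.v *)
From HB Require Import structures.
From mathcomp Require Import all_boot all_order all_algebra zify.
From mathcomp Require Import all_classical all_reals all_analysis measurable_realfun.
Set Implicit Arguments.
Unset Strict Implicit.
Unset Printing Implicit Defensive.
Import Order.TTheory GRing.Theory Num.Theory.
Import numFieldNormedType.Exports.
Local Open Scope classical_set_scope.
Local Open Scope ring_scope.

HB.instance Definition _ (n : nat) := isPointed.Build (ordinal n.+1) ord0.

(* The alphabet {0, ..., b-1} is written 'I_b.-1.+1 rather than 'I_b: for b > 0
   these are the same, and the former is visibly inhabited, which measurable
   types require. *)
Definition coord_sets (b : nat) : set (set (nat -> 'I_b.-1.+1)) :=
  [set C | exists (i : nat) (E : {set 'I_b.-1.+1}), C = [set a | a i \in E]].

Arguments coord_sets : clear implicits.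

Definition seqspace (b : nat) : measurableType (coord_sets b).-sigma :=
  g_sigma_algebraType (coord_sets b).

(* Sequences are indexed from 1 in the mathematics and stored from 0: entry a n
   is a_n, for n >= 1. *)
Definition entry (b : nat) (a : seqspace b) (n : nat) : 'I_b.-1.+1 := a n.-1.

(* lambda is the infinite product of the uniform measure; such a lambda exists
   (uniform_product_exists below) and is unique, the rectangles forming a
   generating pi-system. *)
Definition uniform_product (R : realType) (b : nat)
    (lambda : probability (seqspace b) R) : Prop :=
  forall (n : nat) (E : nat -> {set 'I_b.-1.+1}),
    lambda [set a : seqspace b | forall i : nat, (i < n)%N -> a i \in E i] =
    (\prod_(i < n) (#|E i|%:R / b%:R))%:E.

Definition coprime_to (P : seq nat) (m : nat) : bool :=
  (0 < m)%N && all (fun p => ~~ (p %| m)%N) P.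

(* The initial segment j_1 < j_2 < ... of the enumeration, up to n. *)
Definition jseq (P : seq nat) (n : nat) : seq nat :=
  [seq m <- iota 1 n | coprime_to P m].

(* n`_[predC P] is n stripped of all its prime factors in P, that is, j_k when
   n = j_k p_1^e_1 ... p_r^e_r; then k is its rank, counted from 1, in jseq P n.
   See toeplitzE below. *)
Definition toeplitz (b : nat) (P : seq nat) (a : seqspace b) : seqspace b :=
  fun i => entry a (index (i.+1`_[predC P])%N (jseq P i.+1)).+1.

Definition toeplitz_set (b : nat) (P : seq nat) : set (seqspace b) :=
  [set t | forall n p, (0 < n)%N -> p \in P -> entry t n = entry t (n * p)%N].

Definition expansion_of (R : realType) (b : nat) (t : seqspace b) (x : R) :
    Prop :=
  series (fun j => (entry t j.+1)%:R / b%:R ^+ j.+1 : R) @ \oo --> x.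

(* The j-th digit, j >= 1, of the fractional part of x in base B. *)
Definition base_digit (R : realType) (B : nat) (x : R) (j : nat) : int :=
  (Num.floor (x * B%:R ^+ j) %% B)%Z.

Definition simply_normal (R : realType) (B : nat) (x : R) : Prop :=
  forall d : nat, (d < B)%N ->
    (count (fun j => base_digit B x j == d :> int) (iota 1 n))%:R / n%:R
      @[n --> \oo] --> (B%:R^-1 : R).

Definition normal (R : realType) (b : nat) (x : R) : Prop :=
  forall k : nat, (0 < k)%N -> simply_normal (b ^ k)%N x.

Definition jenumerates (P : seq nat) (j : nat -> nat) : Prop :=
  (forall k l, (0 < k)%N -> (k < l)%N -> (j k < j l)%N) /\
  (forall m, coprime_to P m <-> exists2 k, (0 < k)%N & j k = m).

Lemma coprime_to_partn P n : (0 < n)%N -> all prime P ->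
  coprime_to P (n`_[predC P])%N.
Proof.
move=> n0 /allP pP; rewrite /coprime_to part_gt0; apply/allP => p Pp /=.
apply/negP => pd; have := pP _ Pp => pp.
have : p \in \pi(n`_[predC P])%N by rewrite mem_primes pp part_gt0.
by rewrite pi_of_part // !inE Pp andbF.
Qed.

Lemma partn_coprime_to P m (e : nat -> nat) : all prime P -> coprime_to P m ->
  ((m * \prod_(p <- P) p ^ e p)`_[predC P])%N = m.
Proof.
move=> /allP pP /andP[m0 /allP mP].
have PN : ([predC P]^'.-nat (\prod_(p <- P) p ^ e p))%N.
  rewrite big_seq; apply: (big_ind (fun n => [predC P]^'.-nat n)%N) => //.
    by move=> x y xP yP; rewrite pnatM xP.
  by move=> p Pp; rewrite pnatX (pnatE _ (pP _ Pp)) !inE /= Pp.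
rewrite partnM //; last by case/andP: PN.
rewrite (part_p'nat PN) muln1 part_pnat_id //; apply/andP; split => //; apply/allP => p.
by rewrite mem_primes => /and3P[pp _ pm]; rewrite !inE; apply/negP => /mP/negP.
Qed.

Lemma index_jseq P j k n : jenumerates P j -> (0 < k)%N -> (j k <= n)%N ->
  (index (j k) (jseq P n)).+1 = k.
Proof.
move=> [jincr jP] k0 jkn.
have jk : coprime_to P (j k) by apply/jP; exists k.
have jk0 : (0 < j k)%N by case/andP: jk.
have -> : n = ((j k).-1 + (n - j k).+1)%N by lia.
have -> : jseq P ((j k).-1 + (n - j k).+1) =
    [seq j l | l <- iota 1 k.-1] ++
    (j k :: [seq m <- iota (j k).+1 (n - j k) | coprime_to P m]).
  rewrite /jseq iotaD filter_cat add1n prednK //= jk; congr cat.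
  apply: (irr_sorted_eq ltn_trans ltnn).
  - by apply: (sorted_filter ltn_trans); exact: iota_ltn_sorted.
  - apply: (homo_sorted_in (P := [pred l | 0 < l]%N) (e := ltn)) => //.
    + by move=> x y x0 _; exact: jincr.
    + by apply/allP => l; rewrite mem_iota => /andP[].
    + exact: iota_ltn_sorted.
  move=> m; rewrite mem_filter mem_iota; apply/andP/mapP.
    move=> [/jP[l l0 <-] lk]; exists l => //; rewrite mem_iota l0 /=.
    case: (ltnP l k) => [|kl]; first by lia.
    have : (j k <= j l)%N.
      by move: kl; rewrite leq_eqVlt => /predU1P[->//|/(jincr _ _ k0)/ltnW].
    by lia.
  move=> [l]; rewrite mem_iota => /andP[l0 lk] ->; split.
    by apply/jP; exists l.
  have : (j l < j k)%N by apply: jincr => //; lia.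
  have : coprime_to P (j l) by apply/jP; exists l.
  by move=> /andP[]; lia.
rewrite index_cat; case: ifPn => [/mapP[l]|_].
  rewrite mem_iota => /andP[l0 lk] jkl.
  have : (j l < j k)%N by apply: jincr => //; lia.
  by rewrite jkl ltnn.
by rewrite /= eqxx addn0 size_map size_iota prednK.
Qed.

Lemma entry_toeplitz b P (a : seqspace b) n : (0 < n)%N ->
  entry (toeplitz P a) n = entry a (index (n`_[predC P])%N (jseq P n)).+1.
Proof. by case: n. Qed.

Lemma toeplitzE b P (a : seqspace b) j k (e : nat -> nat) :
    all prime P -> jenumerates P j -> (0 < k)%N ->
  entry (toeplitz P a) (j k * \prod_(p <- P) p ^ e p)%N = entry a k.
Proof.
move=> pP jP k0.
have jk : coprime_to P (j k) by apply/jP.2; exists k.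
have N0 : (0 < \prod_(p <- P) p ^ e p)%N.
  rewrite big_seq prodn_cond_gt0 // => p /(allP pP)/prime_gt0 p0.
  by rewrite expn_gt0 p0.
have jk0 : (0 < j k)%N by case/andP: jk.
rewrite entry_toeplitz ?muln_gt0 ?jk0 // partn_coprime_to //.
by rewrite index_jseq // leq_pmulr.
Qed.

Lemma index_jseq_leq P m n : coprime_to P m -> (m <= n)%N ->
  index m (jseq P n) = index m (jseq P m).
Proof.
move=> mP mn; rewrite /jseq -(subnKC mn) iotaD filter_cat index_cat.
by rewrite mem_filter mP mem_iota; case/andP: mP => -> _; rewrite add1n ltnSn.
Qed.

Lemma toeplitz_range b P : all prime P ->
  range (@toeplitz b P) = toeplitz_set P.
Proof.
move=> pP; apply/seteqP; split => [_ [a _ <-] n p n0 Pp|t tP].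
  have p0 : (0 < p)%N by apply/prime_gt0/(allP pP).
  rewrite !entry_toeplitz ?muln_gt0 ?n0 //.
  have E : ((n * p)`_[predC P] = n`_[predC P])%N.
    rewrite partnM // [X in (_ * X)%N]part_p'nat ?muln1 //.
    by rewrite (pnatE _ (allP pP _ Pp)) !inE Pp.
  have nP := coprime_to_partn n0 pP.
  have nn : (n`_[predC P] <= n)%N by rewrite dvdn_leq // dvdn_part.
  rewrite E !(index_jseq_leq nP) //.
  by rewrite (leq_trans nn) // leq_pmulr.
have tE n : (0 < n)%N -> entry t n = entry t (n`_[predC P])%N.
  elim/ltn_ind: n => n IH n0.
  case: (boolP (has (fun p => p %| n)%N P)) => [/hasP[p Pp pn]|nP].
    have pp := allP pP _ Pp.
    have nE : n = (n %/ p * p)%N by rewrite divnK.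
    have np0 : (0 < n %/ p)%N by rewrite divn_gt0 ?prime_gt0 // dvdn_leq.
    rewrite nE -tP // IH // ?ltn_Pdiv ?prime_gt1 // partnM ?(prime_gt0 pp) //.
    by rewrite [X in (_ * X)%N]part_p'nat ?muln1 // (pnatE _ pp) !inE Pp.
  rewrite part_pnat_id //; apply/andP; split => //; apply/allP => p.
  rewrite mem_primes => /and3P[pp _ pm]; rewrite !inE; apply/negP => Pp.
  by move/negP: nP; apply; apply/hasP; exists p.
have jinj m m' : coprime_to P m -> coprime_to P m' -> (m <= m')%N ->
    index m (jseq P m) = index m' (jseq P m') -> m = m'.
  move=> mP m'P mm'; rewrite -(index_jseq_leq mP mm') => /(congr1 (nth 0 _)%N).
  move=> /(_ (jseq P m')); rewrite !nth_index //.
  - by rewrite mem_filter m'P mem_iota; case/andP: m'P => -> _ /=; rewrite add1n.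
  - by rewrite mem_filter mP mem_iota add1n ltnS mm'; case/andP: mP => ->.
pose jinv i := xget 0%N [set m | coprime_to P m /\ index m (jseq P m) = i].
exists (fun i => entry t (jinv i)) => //.
apply/funext => i; rewrite /toeplitz {1}/entry /= -[RHS]/(entry t i.+1) (tE i.+1) //.
congr entry; set m := (_`_ _)%N.
have mP : coprime_to P m by exact: coprime_to_partn.
rewrite index_jseq_leq //; last by rewrite dvdn_leq // dvdn_part.
rewrite /jinv; case: xgetP => [m' _ [m'P E]|/(_ m)]; last by case.
case: (leqP m' m) => [mm'|/ltnW mm']; first exact: jinj.
by apply/esym/jinj.
Qed.

Lemma measurable_toeplitz b P : measurable_fun setT (@toeplitz b P).
Proof.
apply: (@measurability _ _ (seqspace b) (seqspace b) setT (@toeplitz b P)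
  (coord_sets b)) => //.
move=> _ [_ [i [E ->]] <-]; rewrite setTI.
apply: sub_sigma_algebra.
by exists (index (i.+1`_[predC P])%N (jseq P i.+1)), E.
Qed.

HB.instance Definition _ (b : nat) (P : seq nat) :=
  isMeasurableFun.Build _ _ _ _ (@toeplitz b P) (@measurable_toeplitz b P).

Section uniform_product_exists.
Variables (R : realType) (b : nat).
Local Notation A := 'I_b.-1.+1.

Definition digit_map (x : measurableTypeR R) : seqspace b :=
  fun i => inord `|base_digit b (x : R) i.+1|%N.

Lemma measurable_digit_map : measurable_fun setT digit_map.
Proof.
apply: (@measurability _ _ (measurableTypeR R) (seqspace b) setT digit_map (coord_sets b)) => //.
move=> _ [_ [i [E ->]] <-]; rewrite setTI.
pose f (x : R) := x * b%:R ^+ i.+1.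
have mf : measurable_fun setT f by exact: mulrr_measurable.
rewrite (_ : _ @^-1` _ = \bigcup_(z : int)
    [set x | inord `|(z %% b)%Z|%N \in E /\ Num.floor (f x) = z]).
  apply: countable_bigcupT_measurable => // z.
  case: (boolP ((inord `|(z %% b)%Z|%N : A) \in E)) => zE; last first.
    by rewrite (_ : [set _ | _] = set0) //; apply/seteqP; split => x //= [].
  rewrite (_ : [set _ | _] = f @^-1` `[z%:~R, (z + 1)%:~R[).
    by rewrite -[X in measurable X]setTI; exact: mf.
  apply/seteqP; split => x /=; rewrite in_itv /=.
    by move=> [_ <-]; exact: floor_itv.
  by move/floor_def.
apply/seteqP; split => x /=; first by exists (Num.floor (f x)).
by move=> [z _ [zE fz]]; rewrite /digit_map /base_digit -/(f x) fz.
Qed.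

HB.instance Definition _ :=
  isMeasurableFun.Build _ _ _ _ digit_map measurable_digit_map.

Definition leb01 :=
  mrestr (@lebesgue_measure R) (@measurable_itv R `[0, 1[).

HB.instance Definition _ := Measure.on leb01.

Lemma leb01_setT : leb01 setT = 1%E.
Proof.
by rewrite /leb01 /mrestr setTI lebesgue_measure_itv /= lte_fin ltr01 oppr0 adde0.
Qed.

HB.instance Definition _ := Measure_isProbability.Build _ _ _ leb01 leb01_setT.

Hypothesis b0 : (0 < b)%N.

Let b0R : 0 < b%:R :> R. Proof. by rewrite ltr0n. Qed.

Lemma floor_divz (y : R) : (Num.floor (y * b%:R) %/ b)%Z = Num.floor y.
Proof.
set F := Num.floor (y * _); apply/esym/floor_def.
have /andP[Fl Fu] := floor_itv (y * b%:R); rewrite -/F in Fl Fu.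
have FE := divz_eq F b.
have r0 : 0 <= (F %% b)%Z by apply: modz_ge0; lia.
have r1 : (F %% b)%Z < b by apply: ltz_pmod; lia.
apply/andP; split.
  rewrite -(ler_pM2r b0R) (le_trans _ Fl) // -[b%:R]/(b%:~R) -intrM ler_int; lia.
rewrite -(ltr_pM2r b0R) (lt_le_trans Fu) // -[b%:R]/(b%:~R) -intrM ler_int.
rewrite mulrDl mul1r {1}FE; lia.
Qed.

Let digit_lt (c : A) : (c < b)%N.
Proof. by have := ltn_ord c; move: (nat_of_ord c) => m; lia. Qed.

Fixpoint word_val (w : nat -> A) (n : nat) : nat :=
  if n is m.+1 then (word_val w m * b + w m)%N else 0%N.

Lemma word_val_lt w n : (word_val w n < b ^ n)%N.
Proof.
elim: n => //= n IH; have wb := digit_lt (w n).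
rewrite expnSr; nia.
Qed.

Lemma digit_mapP (w : nat -> A) n (x : R) : 0 <= x < 1 ->
  (forall i, (i < n)%N -> digit_map x i = w i) <->
  Num.floor (x * b%:R ^+ n) = word_val w n :> int.
Proof.
move=> x01; elim: n => [|n [IH1 IH2]].
  by rewrite expr0 mulr1; split=> // _; apply: floor_def; rewrite add0r.
have FS : (Num.floor (x * b%:R ^+ n.+1) %/ b)%Z = Num.floor (x * b%:R ^+ n).
  by rewrite exprSr mulrA floor_divz.
have wb := digit_lt (w n).
have r0 := @modz_ge0 (Num.floor (x * b%:R ^+ n.+1)) b.
have r1 := @ltz_pmod (Num.floor (x * b%:R ^+ n.+1)) b.
have FE := divz_eq (Num.floor (x * b%:R ^+ n.+1)) b.
have dE : digit_map x n = w n <->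
    (Num.floor (x * b%:R ^+ n.+1) %% b)%Z = w n.
  rewrite /digit_map /base_digit; split => [/(congr1 (@nat_of_ord _))|->].
    rewrite inordK; last by rewrite prednK //; lia.
    by lia.
  by apply/val_inj; rewrite /= inordK // prednK.
rewrite /=; split => [H|H].
  have /dE := H n (ltnSn n).
  have := IH1 (fun i ni => H i (ltnW ni)); rewrite -FS; lia.
have FnE : Num.floor (x * b%:R ^+ n) = word_val w n.
  rewrite -FS H PoszD PoszM divzMDl; last by lia.
  by rewrite divz_small ?addr0 //; lia.
move=> i; rewrite ltnS leq_eqVlt => /predU1P[->|]; last exact: IH2.
by apply/dE; move: FE; rewrite FS FnE; lia.
Qed.

Lemma distribution_word (w : nat -> A) n :
  distribution leb01 digit_map [set a | forall i, (i < n)%N -> a i = w i] =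
  (b%:R ^- n)%:E.
Proof.
rewrite /distribution /pushforward /= /leb01 /mrestr.
have bn0 : 0 < b%:R ^+ n :> R by rewrite exprn_gt0.
set v := word_val w n.
rewrite (_ : _ `&` _ = `[v%:R / b%:R ^+ n, (v.+1)%:R / b%:R ^+ n[%classic).
  rewrite lebesgue_measure_itv /= lte_fin ltr_pM2r ?invr_gt0 // ltr_nat ltnSn.
  by rewrite -EFinD -mulrBl -natrB // subSnn mul1r.
have floorE (x : R) : (Num.floor (x * b%:R ^+ n) == v) =
    (v%:R / b%:R ^+ n <= x < (v.+1)%:R / b%:R ^+ n).
  by rewrite floor_eq ler_pdivrMr // ltr_pdivlMr // addrC -intS.
apply/seteqP; split => x /=; rewrite !in_itv /=.
  by move=> [H x01]; rewrite -floorE; apply/eqP/digit_mapP.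
move=> vx.
have x01 : 0 <= x < 1.
  case/andP: vx => v1 v2; rewrite (le_trans _ v1) ?divr_ge0 ?ler0n ?ltW //=.
  rewrite (lt_le_trans v2) // ler_pdivrMr // mul1r -natrX ler_nat.
  exact: word_val_lt.
by split => //; apply/digit_mapP => //; apply/eqP; rewrite floorE.
Qed.

Lemma uniform_product_exists :
  exists lambda : probability (seqspace b) R, uniform_product lambda.
Proof.
exists (distribution leb01 digit_map) => n E.
pose C (w : {ffun 'I_n -> A}) : set (seqspace b) :=
  [set a : seqspace b | forall i : 'I_n, a i = w i].
have mC w : measurable (C w).
  rewrite (_ : C w = \bigcap_(i : 'I_n) [set a : seqspace b | a i = w i]).
    apply: fin_bigcap_measurable => // i _; apply: sub_sigma_algebra.
    exists i, [set w i]%SET; apply/seteqP; split => a /=; rewrite inE.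
      by move=> ->.
    by move/eqP.
  by apply/seteqP; split => a /= H i; [move=> _|]; exact: H.
pose r := enum (family (fun i : 'I_n => E i)).
rewrite (_ : [set _ | _] = \bigcup_(w in [set` r]) C w); last first.
  apply/seteqP; split => a /=.
    move=> aE; exists [ffun i : 'I_n => a i].
      by rewrite /= mem_enum; apply/familyP => i; rewrite ffunE; exact: aE.
    by move=> i; rewrite ffunE.
  move=> [w]; rewrite /= mem_enum => /familyP wE Cw i ni; have := wE (Ordinal ni).
  by rewrite -(Cw (Ordinal ni)).
rewrite measure_fin_bigcup //=; last first.
  by move=> w w' _ _ [a [Ca Ca']]; apply/ffunP => i; rewrite -Ca -Ca'.
have CE w : distribution leb01 digit_map (C w) = (b%:R ^- n)%:E.
  rewrite -(distribution_word (fun i => if insub i is Some j then w j else ord0)).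
  congr (distribution _ _); apply/seteqP; split => a /= H i.
    by move=> ni; rewrite insubT /= -H.
  by rewrite H // valK.
rewrite (eq_fsbigr (fun=> (b%:R ^- n)%:E)) => [|w _]; last exact: CE.
rewrite -fsbig_seq ?enum_uniq // big_enum /= sumEFin sumr_const card_family.
congr EFin; rewrite big_split /= prodr_const card_ord exprVn.
by rewrite -[LHS]mulr_natl foldrE big_map big_enum natr_prod.
Qed.

End uniform_product_exists.

(* Main.v *)
(* The image of the random sequence copies independent letters: t_m and t_n are
   equal when m and n have the same part prime to P, and independent otherwise.
   Fix k and a word of length k, and look at the aligned blocks of length k among
   the first M letters. Two blocks fail to be independent and uniform only if two
   of their positions differ by a ratio of P-smooth numbers, and there are only
   O(sqrt M) P-smooth numbers up to M. Hence all but O(N^(3/2)) of the N^2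
   covariances of the occurrence indicators vanish, so the mean square deviation
   of the frequency is O(n^-2) along N = n^4; this is summable, the frequency
   converges almost surely along fourth powers, and then along all N. A sequence
   with the right block frequencies contains infinitely many zeros, hence is the
   sequence of digits, in the sense of [floor], of the real it expands. *)
Require Import Defs.
From mathcomp Require Import all_boot all_order all_algebra zify ring lra.
From mathcomp Require Import all_classical all_reals all_analysis measurable_realfun.
Set Implicit Arguments.
Unset Strict Implicit.
Unset Printing Implicit Defensive.
Import Order.TTheory GRing.Theory Num.Theory.
Import numFieldNormedType.Exports.
Local Open Scope classical_set_scope.
Local Open Scope ring_scope.

(** * Letters that the transform copies from one another *)

(* [toeplitz P a] reads [a] at position [source P i]: [toeplitz P a i = a (source P i)]. *)
Definition source (P : seq nat) (i : nat) : nat :=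
  index (i.+1`_[predC P])%N (jseq P i.+1).

(** Both stripped parts are entries of the longer list [jseq P j.+1], where [nth] recovers an entry
    from its rank. *)
Lemma source_partn P i j : all prime P -> source P i = source P j ->
  (i.+1`_[predC P] = j.+1`_[predC P])%N.
Proof.
move=> pP; wlog ij : i j / (i <= j)%N => [H|].
  by case: (leqP i j) => [/H//|/ltnW/H {}H /esym/H].
rewrite /source; set m := (i.+1`_ _)%N; set m' := (j.+1`_ _)%N.
have mP : coprime_to P m by exact: coprime_to_partn.
have m'P : coprime_to P m' by exact: coprime_to_partn.
have mi : (m <= i.+1)%N by rewrite dvdn_leq // dvdn_part.
have m'j : (m' <= j.+1)%N by rewrite dvdn_leq // dvdn_part.
have mj : (m <= j.+1)%N by rewrite (leq_trans mi).
rewrite (index_jseq_leq mP mi) -(index_jseq_leq mP mj).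
move=> /(congr1 (nth 0 (jseq P j.+1))%N); rewrite !nth_index //.
- by rewrite mem_filter m'P mem_iota add1n ltnS m'j; case/andP: m'P => ->.
- by rewrite mem_filter mP mem_iota add1n ltnS mj; case/andP: mP => ->.
Qed.

(** * Counting smooth numbers *)

(** Each of the s factors of [(n + s) ^_ s] is at least n + 1, and this falling factorial is s!
    times a binomial coefficient, at most 2^(n + s). With n a logarithm, it bounds powers of
    logarithms linearly. *)
Lemma expn_leq_pow2 s n : (n.+1 ^ s <= s`! * 2 ^ (n + s))%N.
Proof.
have binle m k : ('C(m, k) <= 2 ^ m)%N.
  elim: m k => [|m IH] [|k] //; first by rewrite bin0 expn_gt0.
  by rewrite binS expnS mul2n -addnn leq_add.
have ffactle : (n.+1 ^ s <= (n + s) ^_ s)%N.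
  elim: s => // s IH; rewrite addnS ffactSS expnS leq_mul //.
  by rewrite ltnS leq_addr.
by rewrite (leq_trans ffactle) // -bin_ffact mulnC leq_mul.
Qed.

(** [[predC P]^'] is [P] itself, in the form in which [partnC] splits off the smooth factor of a
    number. *)
Definition smooth (P : seq nat) (u : nat) : bool := ([predC P]^'.-nat u)%N.

Definition smooths (P : seq nat) (M : nat) : seq nat :=
  [seq u <- iota 1 M | smooth P u].

Lemma mem_smooths P M u :
  (u \in smooths P M) = [&& smooth P u, 0 < u & u <= M]%N.
Proof. by rewrite mem_filter mem_iota add1n ltnS. Qed.

(* A smooth number is determined by its exponents, each at most log_2 M. *)
Lemma size_smooths P M :
  (size (smooths P M) <= (trunc_log 2 M).+1 ^ size P)%N.
Proof.
set L := trunc_log 2 M.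
pose f u := [ffun i : 'I_(size P) => (inord (logn (nth 0%N P i) u) : 'I_L.+1)].
have finj : {in smooths P M &, injective f}.
  move=> u v; rewrite !mem_smooths => /and3P[su u0 uM] /and3P[sv v0 vM] fuv.
  have logL w p : (0 < w)%N -> (w <= M)%N -> (logn p w < L.+1)%N.
    move=> w0 wM; rewrite ltnS; case: (boolP (prime p)) => pp; last first.
      by rewrite lognE (negbTE pp).
    rewrite /L -(@trunc_expnK 2 (logn p w)) //; apply: leq_trunc_log.
    apply: leq_trans wM; rewrite (@leq_trans (p ^ logn p w)%N) //.
      by case: (logn p w) => // l; rewrite leq_exp2r // prime_gt1.
    by rewrite dvdn_leq // pfactor_dvdnn.
  apply: eqn_from_log => // p.
  case: (boolP (p \in P)) => [pP|npP].
    have ip : (index p P < size P)%N by rewrite index_mem.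
    have /(congr1 val) := congr1 (fun g : {ffun _ -> _} => g (Ordinal ip)) fuv.
    by rewrite /f !ffunE /= nth_index // !inordK // logL.
  have log0 w : smooth P w -> (0 < w)%N -> logn p w = 0%N.
    move=> sw w0; apply/eqP; rewrite -leqn0 leqNgt logn_gt0; apply/negP.
    by move: sw => /andP[_ /allP H] /H; rewrite !inE npP.
  by rewrite !log0.
rewrite -(size_map f); set s := map f _.
have us : uniq s by rewrite map_inj_in_uniq // filter_uniq // iota_uniq.
by rewrite -(card_uniqP us) (leq_trans (max_card _)) // card_ffun !card_ord.
Qed.

(** The count is at most a fixed power of a logarithm of M; its square is another such power, which
    [expn_leq_pow2] makes linear in M. *)
Lemma size_smooths_sqr P : exists C, forall M, (0 < M)%N ->
  (size (smooths P M) ^ 2 <= C * M)%N.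
Proof.
pose s := (size P * 2)%N; exists (s`! * 2 ^ s)%N => M M0.
rewrite (@leq_trans ((trunc_log 2 M).+1 ^ s)%N) //.
  by rewrite /s expnM leq_sqr size_smooths.
rewrite (leq_trans (expn_leq_pow2 _ _)) // expnD mulnCA mulnC leq_mul2l.
by rewrite trunc_logP ?orbT.
Qed.

Lemma size_smooths_pow4 P k : (0 < k)%N -> exists C, forall n, (0 < n)%N ->
  (size (smooths P (k * n ^ 4)) <= C * n ^ 2)%N.
Proof.
move=> k0; have [C HC] := size_smooths_sqr P; exists (C * k)%N => n n0.
rewrite -leq_sqr; apply: leq_trans (HC _ _) _; first by rewrite muln_gt0 k0 expn_gt0 n0.
(* The constant survives the square root because [C * k <= (C * k) ^ 2] in the naturals. *)
by rewrite mulnA expnMn -expnM leq_mul2r; apply/orP; right; nia.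
Qed.

(** * Counting dependent pairs of blocks *)

Definition block (k i : nat) : seq nat := iota (k * i) k.

Lemma mem_block k i x : (x \in block k i) -> (x %/ k = i)%N.
Proof.
rewrite mem_iota => /andP[x1 x2].
have -> : x = (i * k + (x - k * i))%N by lia.
by rewrite divnMDl ?divn_small; lia.
Qed.

Lemma block_ltn k i N x : (i < N)%N -> x \in block k i -> (x < k * N)%N.
Proof.
move=> iN; rewrite mem_iota => /andP[_ xi].
by rewrite (leq_trans xi) // -mulnSr leq_mul2l iN orbT.
Qed.

(** Distinct sources make the 2k letters distinct coordinates of the original sequence, hence
    independent and uniform. For k > 0 the pairs with i = j count as dependent. *)
Definition independent_blocks (P : seq nat) (k i j : nat) : bool :=
  uniq (map (source P) (block k i ++ block k j)).

(** The predecessor turns a position counted from 1 into a stored one. Repeated entries do no harm: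
    only the length, k times the number of smooth numbers, enters the bound. *)
Definition self_clashing (P : seq nat) (k M : nat) : seq nat :=
  [seq ((c * u).-1 %/ k)%N | c <- iota 0 k, u <- smooths P M].

(* Two equal letters in a block come from c * u and c * v with c (v - u) < k. *)
Lemma mem_self_clashing P k N i : all prime P -> (i < N)%N ->
  ~~ uniq (map (source P) (block k i)) -> i \in self_clashing P k (k * N).
Proof.
move=> pP iN; apply: contraR => ni.
rewrite map_inj_in_uniq ?iota_uniq // => x y xi yi xy.
wlog ltxy : x y xi yi xy / (x < y)%N => [H|].
  by case: (ltngtP x y) => // [/H->//|/H H']; apply/esym/H'.
case/negP: ni; have c := source_partn pP xy.
have := mem_block xi.
move: (xi) (yi); rewrite !mem_iota => xr yr xki.
have cx := partnC [predC P] (ltn0Sn x); have cy := partnC [predC P] (ltn0Sn y).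
set cc := (x.+1`_[predC P])%N in c cx; set u := (x.+1`_([predC P]^'))%N in cx.
rewrite -c in cy; set v := (y.+1`_ _)%N in cy.
apply/allpairsP; exists (cc, u); split => /=.
(* [cc] divides both positions, counted from 1, hence their difference, which is positive and less
   than k. *)
- have dvd : (cc %| y - x)%N.
    have -> : (y - x = y.+1 - x.+1)%N by lia.
    by rewrite -cx -cy -mulnBr dvdn_mulr.
  have := dvdn_leq (_ : 0 < y - x)%N dvd; rewrite mem_iota; lia.
- rewrite mem_smooths /smooth part_pnat part_gt0 /=.
  by rewrite (leq_trans _ (block_ltn iN xi)) // dvdn_leq ?dvdn_part.
- by rewrite cx.
Qed.

(** The position x in one block and the smooth factor u of its partner in the other determine both
    blocks, since the two positions share their part prime to [P]. *)
Lemma mem_cross_clashing P k N i j : all prime P -> (i < N)%N -> (j < N)%N ->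
  has (mem (map (source P) (block k i))) (map (source P) (block k j)) ->
  (i, j) \in [seq (x %/ k, (x.+1`_[predC P] * u).-1 %/ k)%N
               | x <- iota 0 (k * N), u <- smooths P (k * N)].
Proof.
move=> pP iN jN /hasP[_ /mapP[y yj ->] /mapP[x xi xy]].
have c := source_partn pP xy.
have cy := partnC [predC P] (ltn0Sn y).
apply/allpairsP; exists (x, (y.+1`_([predC P]^'))%N); split => /=.
- by rewrite mem_iota (block_ltn iN xi).
- rewrite mem_smooths /smooth part_pnat part_gt0 /=.
  by rewrite (leq_trans _ (block_ltn jN yj)) // dvdn_leq ?dvdn_part.
- by rewrite -c cy (mem_block xi) (mem_block yj).
Qed.

(** A repeated source lies within the first block, across the two, or within the second; [l1], [l2],
    [l3] cover these cases, each with [k * N * size D] entries. *)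
Lemma count_dependent_blocks P k N : all prime P ->
  (\sum_(i < N) \sum_(j < N) ~~ independent_blocks P k i j <=
   3 * (k * N) * size (smooths P (k * N)))%N.
Proof.
move=> pP; set D := smooths P (k * N).
pose s := [seq ij <- [seq (i, j) | i <- iota 0 N, j <- iota 0 N] |
           ~~ independent_blocks P k ij.1 ij.2].
have -> : (\sum_(i < N) \sum_(j < N) ~~ independent_blocks P k i j)%N = size s.
  rewrite size_filter -sum1_count [RHS]big_mkcond big_allpairs_dep /=.
  rewrite -(big_mkord xpredT (fun i =>
    \sum_(j < N) ~~ independent_blocks P k i j)%N) /index_iota subn0.
  apply: eq_bigr => i _; rewrite -(big_mkord xpredT (fun j =>
    nat_of_bool (~~ independent_blocks P k i j))) /index_iota subn0.
  by apply: eq_bigr => j _; case: ifP.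
pose l1 := [seq (i, j) | i <- self_clashing P k (k * N), j <- iota 0 N].
pose l2 := [seq (x %/ k, (x.+1`_[predC P] * u).-1 %/ k)%N
               | x <- iota 0 (k * N), u <- D].
pose l3 := [seq (i, j) | i <- iota 0 N, j <- self_clashing P k (k * N)].
have us : uniq s.
  by apply/filter_uniq/allpairs_uniq; rewrite ?iota_uniq // => -[? ?] [? ?].
have sub : {subset s <= l1 ++ l2 ++ l3}.
  move=> [i j]; rewrite mem_filter /= => /andP[dep /allpairsP[[i' j']] /= []].
  rewrite !mem_iota !add0n => /andP[_ iN] /andP[_ jN] [? ?]; subst i' j'.
  move: dep; rewrite /independent_blocks map_cat cat_uniq !negb_and negbK.
  rewrite !mem_cat => /or3P[bi|hij|bj].
  - apply/or3P/Or31/allpairsP; exists (i, j).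
    by rewrite /= mem_self_clashing // mem_iota.
  - by apply/or3P/Or32/mem_cross_clashing.
  - apply/or3P/Or33/allpairsP; exists (i, j).
    by rewrite /= mem_self_clashing // mem_iota.
apply: leq_trans (uniq_leq_size us sub) _.
rewrite !size_cat !size_allpairs !size_iota -/D; move: (size D) => D'; nia.
Qed.

(** * Digits of the expanded real, and normality *)

Section expansion.
Variables (R : realType) (b : nat).
Hypothesis b_ge2 : (2 <= b)%N.
Local Notation A := 'I_b.-1.+1.

Let b_gt0 : (0 < b)%N. Proof. exact: ltnW. Qed.

Lemma letter_lt (c : A) : (c < b)%N.
Proof. by rewrite (leq_trans (ltn_ord c)) // prednK. Qed.

Lemma word_valD (w : nat -> A) m n :
  word_val w (m + n) =
  (word_val w m * b ^ n + word_val (fun i => w (m + i)%N) n)%N.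
Proof.
elim: n => [|n IH]; first by rewrite addn0 muln1 addn0.
by rewrite addnS /= IH expnSr mulnDl mulnA addnA.
Qed.

Lemma word_val_inj (v w : nat -> A) n : word_val v n = word_val w n <->
  forall i, (i < n)%N -> v i = w i.
Proof.
elim: n => [|n [IH1 IH2]] /=; first by split.
have vb := letter_lt (v n); have wb := letter_lt (w n); split.
  move=> E.
  have E1 : word_val v n = word_val w n.
    have := congr1 (fun m => m %/ b)%N E.
    by rewrite !divnMDl // !divn_small // !addn0.
  have E2 : v n = w n.
    by apply/val_inj; move: E; rewrite E1 => /addnI.
  by move=> i; rewrite ltnS leq_eqVlt => /predU1P[->//|]; exact: IH1.
by move=> E; rewrite IH2 => [|i ni]; rewrite E // ltnW.
Qed.

Lemma word_val_surj n d : (d < b ^ n)%N -> exists w : nat -> A, word_val w n = d.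
Proof.
elim: n d => [|n IH] d dn; first by exists (fun=> ord0); case: d dn.
have [|w Hw] := IH (d %/ b)%N; first by rewrite ltn_divLR // -expnSr.
exists (fun i => if i == n then inord (d %% b) else w i) => /=.
rewrite eqxx inordK; last by rewrite prednK // ltn_pmod.
rewrite [RHS](divn_eq d b) -Hw; congr (_ * _ + _)%N; apply/word_val_inj => i ni.
by rewrite (ltn_eqF ni).
Qed.

Definition prefix_val (t : seqspace b) (n : nat) : R :=
  (word_val t n)%:R / b%:R ^+ n.

Let bX_gt0 n : 0 < b%:R ^+ n :> R.
Proof. by rewrite exprn_gt0 // ltr0n. Qed.

Let bX_neq0 n : b%:R ^+ n != 0 :> R. Proof. exact: lt0r_neq0. Qed.

Lemma prefix_valD t m n : prefix_val t (m + n) =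
  prefix_val t m + (word_val (fun i => t (m + i)%N) n)%:R / b%:R ^+ (m + n).
Proof.
rewrite /prefix_val word_valD natrD natrM natrX mulrDl; congr (_ + _).
by rewrite exprD -mulf_div divff // mulr1.
Qed.

Lemma series_prefix_val t :
  series (fun j => (entry t j.+1)%:R / b%:R ^+ j.+1 : R) = prefix_val t.
Proof.
apply/funext => n; elim: n => [|n IH].
  by rewrite /series /= big_geq // /prefix_val mul0r.
rewrite seriesSr IH -[in RHS]addn1 prefix_valD /= addn0 mul0n add0n.
by rewrite addn1.
Qed.

Lemma prefix_val_homo t : {homo prefix_val t : m n / (m <= n)%N >-> m <= n}.
Proof.
move=> m n /subnKC <-; rewrite prefix_valD lerDl.
by rewrite divr_ge0 ?ler0n // ltW.
Qed.

Lemma prefix_val_upperE t m n : prefix_val t (m + n) + b%:R ^- (m + n) =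
  prefix_val t m + (word_val (fun i => t (m + i)%N) n).+1%:R / b%:R ^+ (m + n).
Proof. by rewrite prefix_valD -addrA -natr1 mulrDl mul1r. Qed.

Lemma prefix_val_upper t m n : prefix_val t (m + n) <= prefix_val t m + b%:R ^- m.
Proof.
apply: (@le_trans _ _ (prefix_val t (m + n) + b%:R ^- (m + n))).
  by rewrite lerDl invr_ge0 ltW.
rewrite prefix_val_upperE lerD2l ler_pdivrMr // exprD mulKf // -natrX ler_nat.
exact: word_val_lt.
Qed.

(** A last digit 0 keeps the value of the tail at most b^(n + 1) - b, so adding one still falls
    short of b^(n + 1), as b >= 2. *)
Lemma prefix_val_upper_lt t m n : t (m + n)%N = ord0 ->
  prefix_val t (m + n.+1) + b%:R ^- (m + n.+1) < prefix_val t m + b%:R ^- m.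
Proof.
move=> t0; rewrite prefix_val_upperE ltrD2l ltr_pdivrMr // exprD mulKf //.
rewrite -natrX ltr_nat /= t0 addn0 expnSr.
have := word_val_lt R b_gt0 (fun i => t (m + i)%N) n.
nia.
Qed.

Lemma prefix_val_cvg t : exists2 x : R, expansion_of t x &
  forall m, prefix_val t m <= x <= prefix_val t m + b%:R ^- m.
Proof.
have cv : cvgn (prefix_val t).
  apply: nondecreasing_is_cvgn; first exact: prefix_val_homo.
  exists (prefix_val t 0 + b%:R ^- 0) => _ [n _ <-]; exact: (prefix_val_upper t 0 n).
exists (limn (prefix_val t)); first by rewrite /expansion_of series_prefix_val.
move=> m; apply/andP; split.
  by apply: nondecreasing_cvgn_le => //; exact: prefix_val_homo.
apply: limr_le => //; exists m => // n /= /subnKC <-; exact: prefix_val_upper.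
Qed.

(** The zeros exclude a tail of digits b - 1, the only case in which the real reaches the right end
    of its b-adic interval and [floor] rounds up. *)
Lemma floor_expansion t (x : R) :
    (forall m, prefix_val t m <= x <= prefix_val t m + b%:R ^- m) ->
    (forall m, exists2 n, (m <= n)%N & t n = ord0) ->
  forall m, Num.floor (x * b%:R ^+ m) = word_val t m :> int.
Proof.
move=> xb t0 m; apply: floor_def; apply/andP; split.
  by rewrite -ler_pdivrMr //; case/andP: (xb m).
rewrite -ltr_pdivlMr // intrD mulrDl mul1r.
have [n mn tn] := t0 m.
have := @prefix_val_upper_lt t m (n - m); rewrite subnKC // => /(_ tn).
by apply: le_lt_trans; case/andP: (xb (m + (n - m).+1)%N).
Qed.

Definition block_val (t : seqspace b) (k i : nat) : nat :=
  word_val (fun l => t (k * i + l)%N) k.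

Definition block_freq (t : seqspace b) (k d n : nat) : R :=
  (count (fun i => block_val t k i == d) (iota 0 n))%:R / n%:R.

Lemma zero_infinitely_often (t : seqspace b) :
    block_freq t 1 0 n @[n --> \oo] --> (b%:R^-1 : R) ->
  forall m, exists2 n, (m <= n)%N & t n = ord0.
Proof.
move=> fr m; apply: contrapT => tm.
have bi0 : 0 < b%:R^-1 :> R by rewrite invr_gt0 ltr0n.
have bi2 : b%:R^-1 / 2 < b%:R^-1 :> R.
  by rewrite ltr_pdivrMr // ltr_pMr // ltr1n.
have [N _ HN] := cvgr_gt _ fr _ bi2.
(* If the zeros all lie before m, there are at most m of them, so past 2bm letters their frequency
   is at most half of 1/b. *)
have := HN (maxn N (m * (b * 2)).+1) (leq_maxl _ _); apply/negP; rewrite -leNgt.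
set n := maxn _ _; have n0 : (0 < n)%N by rewrite /n; lia.
rewrite ler_pdivrMr ?ltr0n // -invfM mulrC ler_pdivlMr; last first.
  by rewrite -(natrM _ _ 2) ltr0n; lia.
rewrite -(natrM _ _ 2) -natrM ler_nat.
apply: (@leq_trans (m * (b * 2))%N); last by rewrite /n; lia.
rewrite leq_mul2r; apply/orP; right; rewrite -size_filter -[leqRHS](size_iota 0).
apply: uniq_leq_size; first by rewrite filter_uniq // iota_uniq.
move=> i; rewrite mem_filter mem_iota /block_val /= mul1n addn0 => /andP[/eqP ti _].
rewrite mem_iota add0n ltnNge; apply/negP => mi; apply: tm; exists i => //.
exact/val_inj.
Qed.

(** A digit in base b^k is the value of an aligned block of k digits in base b. The case k = 1, d =
    0 supplies the zeros that make the letters of t the digits of x. *)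
Lemma normal_of_block_freq (t : seqspace b) :
    (forall k d, (0 < k)%N -> (d < b ^ k)%N ->
      block_freq t k d n @[n --> \oo] --> ((b ^ k)%N%:R^-1 : R)) ->
  exists x : R, expansion_of t x /\ normal b x.
Proof.
move=> fr; have [x tx xb] := prefix_val_cvg t; exists x; split => // k k0 d dk.
have t0 : forall m, exists2 n, (m <= n)%N & t n = ord0.
  by apply: zero_infinitely_often; rewrite -[in X in _ --> X](expn1 b); apply: fr.
suff -> : (fun n => (count (fun j => base_digit (b ^ k) x j == d :> int)
    (iota 1 n))%:R / n%:R) = block_freq t k d by exact: fr.
apply/funext => n; rewrite /block_freq -[1%N]addn0 iotaDl count_map.
congr (_%:R / _); apply: eq_count => i /=.
rewrite /base_digit natrX -exprM (floor_expansion xb t0) add1n mulnSr word_valD.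
rewrite modz_nat eqz_nat modnMDl modn_small //; exact: word_val_lt.
Qed.

End expansion.

(** * Convergence of means along fourth powers *)

Lemma fourth_root_floor N : (0 < N)%N ->
  exists m, (m.+1 ^ 4 <= N < m.+2 ^ 4)%N.
Proof.
elim: N => // -[|N] IH _; first by exists 0%N.
have [//|m /andP[m1 m2]] := IH.
case: (ltnP N.+2 (m.+2 ^ 4)) => [h|h].
  by exists m; rewrite h (leq_trans m1).
by exists m.+1; rewrite h (leq_ltn_trans m2) // ltn_exp2r.
Qed.

(** From the last fourth power a up to N, both the count and q times the length grow by at most N -
    a, which is of order a^(3/4) and so negligible against a. *)
Lemma cvg_mean_of_fourth_powers (R : realType) (c : nat -> nat) (q : R) :
    0 <= q <= 1 -> (forall n, (c n <= c n.+1 <= (c n).+1)%N) ->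
    ((c (n.+1 ^ 4)%N)%:R / (n.+1 ^ 4)%N%:R - q) ^+ 2 @[n --> \oo] --> (0 : R) ->
  (c n)%:R / n%:R @[n --> \oo] --> q.
Proof.
move=> /andP[q0 q1] cS csq.
have cD n m : (c n <= c (n + m) <= c n + m)%N.
  elim: m => [|m IH]; first by rewrite !addn0 leqnn.
  by have := cS (n + m)%N; rewrite !addnS; lia.
apply/cvgrPdist_le => e e0.
have e20 : 0 < (e / 2) ^+ 2 by rewrite exprn_gt0 // divr_gt0.
have [n1 _ H1] := cvgr_lt _ csq _ e20.
(* The gap below has constant 15, and 15 * (e / 30) is half of e. *)
have e30 : 0 < e / 30 by rewrite divr_gt0.
have [n2 _ H2] := near_infty_natSinv_lt (PosNum e30).
exists ((maxn n1 n2).+2 ^ 4)%N => // N /= HN.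
have N0 : (0 < N)%N by rewrite (leq_trans _ HN) // expn_gt0.
have [m /andP[mN Nm]] := fourth_root_floor N0.
have nm : (maxn n1 n2 <= m)%N.
  by have := leq_ltn_trans HN Nm; rewrite ltn_exp2r // ltnS => /ltnW.
have {}H1 := H1 m (leq_trans (leq_maxl _ _) nm).
have {}H2 : m.+1%:R^-1 < e / 30 := H2 m (leq_trans (leq_maxr _ _) nm).
have {H1} : `|(c (m.+1 ^ 4)%N)%:R / (m.+1 ^ 4)%N%:R - q| <= e / 2.
  apply: ltW; rewrite -(@ltr_pXn2r _ 2) // ?nnegrE ?divr_ge0 ?ltW //.
  by rewrite real_normK ?num_real.
have /andP[c1 c2] := cD (m.+1 ^ 4)%N (N - m.+1 ^ 4)%N.
rewrite subnKC // in c1 c2.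
(* For x >= 1, (x + 1)^4 - x^4 = 4x^3 + 6x^2 + 4x + 1 <= 15x^3. *)
have gap : (N - m.+1 ^ 4 <= 15 * m.+1 ^ 3)%N.
  by move: Nm; rewrite !expnS expn0; move: N {c1 c2 mN HN N0} => N; nia.
set a := (m.+1 ^ 4)%N in c1 c2 mN gap *.
have a0 : 0 < a%:R :> R by rewrite ltr0n expn_gt0.
have NR0 : 0 < N%:R :> R by rewrite ltr0n.
have {}c2 : (c N)%:R - (c a)%:R <= N%:R - a%:R :> R.
  have : (c N + a <= c a + N)%N by lia.
  by rewrite -(ler_nat R) !natrD; lra.
have {}gap : N%:R - a%:R <= 15 * (a%:R / m.+1%:R) :> R.
  rewrite -natrB // (_ : 15 * _ = (15 * m.+1 ^ 3)%N%:R) ?ler_nat //.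
  rewrite natrM /a expnSr (natrM _ (m.+1 ^ 3)%N) mulfK ?pnatr_eq0 //.
rewrite -(ler_nat R) in mN; rewrite -(ler_nat R) in c1.
move=> H1.
have {}H1 : `|(c a)%:R - q * a%:R| <= e / 2 * a%:R.
  rewrite -[X in _ - q * X](gtr0_norm a0) -{1}[(c a)%:R](@divfK _ a%:R) ?gt_eqF //.
  by rewrite (gtr0_norm a0) -mulrBl normrM (gtr0_norm a0) ler_wpM2r // ltW.
have {}gap : N%:R - a%:R <= e / 2 * a%:R.
  apply: (le_trans gap); rewrite mulrCA mulrC ler_wpM2r ?ltW //.
  by move: (m.+1%:R^-1) H2 => z H2; lra.
have H : `|(c N)%:R - q * N%:R| <= e * N%:R.
  move: H1; rewrite !ler_norml => /andP[H1 H1'].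
  have qN : 0 <= q * (N%:R - a%:R) <= N%:R - a%:R.
    by rewrite mulr_ge0 ?subr_ge0 //= ler_piMl ?subr_ge0.
  apply/andP; split; nra.
rewrite distrC -(ler_pM2r NR0) -{2}(gtr0_norm NR0) -normrM mulrBl divfK //.
by rewrite gt_eqF.
Qed.

(** * Almost sure convergence from summable integrals *)

Lemma sum_inv_sqr_le (R : realType) n :
  \sum_(0 <= i < n) (i.+1%:R ^+ 2)^-1 <= 2 :> R.
Proof.
(* The stronger bound telescopes: 1/(x + 1)^2 <= 1/x - 1/(x + 1). The inverse of 0 being 0, the step
   from 0 to 1 is done apart. *)
suff: \sum_(0 <= i < n) (i.+1%:R ^+ 2)^-1 <= 2 - n%:R^-1 :> R.
  by move=> /le_trans; apply; rewrite gerBl invr_ge0.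
elim: n => [|n IH]; first by rewrite big_geq // invr0 subr0.
rewrite big_nat_recr //=; case: n IH => [_|n IH].
  by rewrite big_geq // add0r expr1n invr1; lra.
apply: (le_trans (lerD IH (lexx _))).
rewrite -addrA lerD2l; have x0 : 0 < n.+1%:R :> R by rewrite ltr0n.
have -> : n.+2%:R = n.+1%:R + 1 :> R by rewrite natr1.
move: n.+1%:R x0 => x x0.
have -> : - x^-1 + ((x + 1) ^+ 2)^-1 = - (x + 1)^-1 - (x * (x + 1) ^+ 2)^-1.
  by field; rewrite !lt0r_neq0 //; lra.
by rewrite gerBl invr_ge0 mulr_ge0 ?sqr_ge0 // ltW.
Qed.

(** The integrals are summable, so the sum of the [f n] is integrable, hence finite almost
    everywhere, and the terms of a convergent series tend to 0. *)
Lemma ae_cvg0_of_integral_bound (d : measure_display) (T : measurableType d)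
    (R : realType) (mu : {measure set T -> \bar R}) (f : nat -> T -> R) (C : R) :
    (forall n, measurable_fun setT (f n)) -> (forall n x, 0 <= f n x) ->
    (forall n, \int[mu]_x (f n x)%:E <= (C / n.+1%:R ^+ 2)%:E)%E ->
  {ae mu, forall x, f n x @[n --> \oo] --> 0}.
Proof.
move=> mf f0 fC.
have mF n : measurable_fun setT (EFin \o f n) by exact/measurable_EFinP.
have F0 n x : (0 <= (f n x)%:E)%E by rewrite lee_fin.
have C0 : 0 <= C.
  have := fC 0%N; rewrite expr1n divr1 -lee_fin; apply: le_trans.
  exact: integral_ge0.
pose F x := (\sum_(0 <= n <oo) (f n x)%:E)%E.
have iF : mu.-integrable setT F.
  apply/integrableP; split.
    apply: (@ge0_emeasurable_sum _ _ _ setT (fun n x => (f n x)%:E) xpredT) => n //.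
    by move=> _; exact: mF.
  under eq_integral => x _ do rewrite gee0_abs ?nneseries_ge0 //.
  rewrite integral_nneseries //; apply: (@le_lt_trans _ _ (C * 2)%:E); last exact: ltry.
  apply: lime_le.
    by apply: is_cvg_nneseries => n _ _; exact: integral_ge0.
  apply: nearW => n; apply: (@le_trans _ _ (\sum_(0 <= i < n) (C / i.+1%:R ^+ 2)%:E)%E).
    by apply: lee_sum => i _; exact: fC.
  by rewrite sumEFin lee_fin -mulr_sumr ler_wpM2l // sum_inv_sqr_le.
apply: filterS (integrable_ae measurableT iF) => x /(_ Logic.I) Fx.
apply: cvg_series_cvg_0; apply: nnseries_is_cvg => //.
by rewrite ltey_eq; move: Fx => /= ->.
Qed.

(** * Second moments of occurrence counts *)

Section second_moment.
Variables (d : measure_display) (T : measurableType d) (R : realType).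
Variables (mu : probability T R) (B : nat -> set T) (q : R).
Hypothesis mB : forall i, measurable (B i).
Hypothesis q01 : 0 <= q <= 1.

Let bounded_integrable (f : T -> R) (M : R) : measurable_fun setT f ->
  (forall x, `|f x| <= M) -> mu.-integrable setT (EFin \o f).
Proof.
move=> mf fM; apply: measurable_bounded_integrable => //.
  by apply: (le_lt_trans (probability_le1 _ _)) => //; exact: ltry.
exists M; split; first exact: num_real.
by move=> y My x _ /=; exact: le_trans (fM x) (ltW My).
Qed.

Let indic01 (A : set T) x : 0 <= (\1_A x : R) <= 1.
Proof. by rewrite indicE; case: (_ \in _); rewrite /= ?lexx ?ler01. Qed.

Let mindic (A : set T) : measurable A -> measurable_fun setT (\1_A : T -> R).
Proof. by move=> mA; exact: measurable_indic. Qed.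

Let indic_integrable A : measurable A -> mu.-integrable setT (EFin \o \1_A).
Proof.
move=> mA; apply: (@bounded_integrable _ 1); first exact: mindic.
by move=> x; have /andP[h0 h1] := indic01 A x; rewrite ger0_norm.
Qed.

Definition centered (i : nat) (x : T) : R := \1_(B i) x - q.

Lemma measurable_centered i : measurable_fun setT (centered i).
Proof. by apply: measurable_funB => //; exact: mindic. Qed.

Let centered_le1 i x : `|centered i x| <= 1.
Proof.
have := indic01 (B i) x; rewrite /centered ler_norml.
by move: (\1_(B i) x) q01 => y; lra.
Qed.

Let centeredM_le1 i j x : `|centered i x * centered j x| <= 1.
Proof. by rewrite normrM mulr_ile1. Qed.

Let centeredM_integrable i j :
  mu.-integrable setT (EFin \o (fun x => centered i x * centered j x)).
Proof.
apply: (@bounded_integrable _ 1) => [|x]; last exact: centeredM_le1.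
by apply: measurable_funM; exact: measurable_centered.
Qed.

Let Rintegral_indic A : measurable A -> \int[mu]_x \1_A x = fine (mu A).
Proof. by move=> mA; rewrite /Rintegral integral_indic // setIT. Qed.

Let Rintegral_const r : \int[mu]_x r = r.
Proof.
by transitivity (r * fine (mu setT)); [exact: Rintegral_cst|rewrite probability_setT mulr1].
Qed.

(** Expanding the covariance leaves q^2 + q^2 - (q^2 + q^2). *)
Lemma integral_centeredM_eq0 i j : mu (B i) = q%:E -> mu (B j) = q%:E ->
    mu (B i `&` B j) = (q ^+ 2)%:E ->
  \int[mu]_x (centered i x * centered j x) = 0.
Proof.
move=> Bi Bj Bij.
have -> : (fun x => centered i x * centered j x) = (fun x =>
    \1_(B i `&` B j) x + q ^+ 2 - (q * \1_(B i) x + q * \1_(B j) x)).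
  by apply/funext => x; rewrite /centered indicI /=; ring.
have mBij : measurable (B i `&` B j) by exact: measurableI.
have icst : mu.-integrable setT (EFin \o (fun=> q ^+ 2)).
  by apply: (@bounded_integrable _ (`|q ^+ 2|)).
have iZ k : mu.-integrable setT (EFin \o (fun x => q * \1_(B k) x)).
  exact: (integrableZl measurableT q (indic_integrable (mB k))).
have iD : mu.-integrable setT (EFin \o (fun x => \1_(B i `&` B j) x + q ^+ 2)).
  exact: (integrableD measurableT (indic_integrable mBij) icst).
have iD' : mu.-integrable setT (EFin \o (fun x => q * \1_(B i) x + q * \1_(B j) x)).
  exact: (integrableD measurableT (iZ i) (iZ j)).
rewrite RintegralB // !RintegralD //; last exact: indic_integrable.
rewrite Rintegral_const // (@RintegralZl _ _ _ _ _ _ q _ (indic_integrable (mB i))) //.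
rewrite (@RintegralZl _ _ _ _ _ _ q _ (indic_integrable (mB j))) //.
by rewrite !Rintegral_indic // Bi Bj Bij /=; ring.
Qed.

(** The square is a double sum of products; an independent pair integrates to 0, any other to at
    most 1. *)
Lemma second_moment_le (indep : rel nat) N :
    (forall i j, indep i j -> [/\ mu (B i) = q%:E, mu (B j) = q%:E &
                               mu (B i `&` B j) = (q ^+ 2)%:E]) ->
  (\int[mu]_x ((\sum_(i < N) centered i x) ^+ 2)%:E <=
   ((\sum_(i < N) \sum_(j < N) ~~ indep i j)%N%:R)%:E)%E.
Proof.
move=> indepP.
have sqE x : ((\sum_(i < N) centered i x) ^+ 2)%:E =
    (\sum_(i < N) \sum_(j < N) (centered i x * centered j x)%:E)%E.
  rewrite expr2 big_distrlr /= -sumEFin; apply: eq_bigr => i _.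
  by rewrite -sumEFin.
under eq_integral do rewrite sqE.
rewrite integral_sum //; last first.
  by move=> i; apply: integrable_sum => // j _; exact: centeredM_integrable.
rewrite natr_sum -sumEFin; apply: lee_sum => i _.
rewrite integral_sum //; last by move=> j; exact: centeredM_integrable.
rewrite natr_sum -sumEFin; apply: lee_sum => j _.
rewrite -[leLHS]fineK; last exact: integrable_fin_num (centeredM_integrable _ _).
rewrite lee_fin -/(Rintegral mu setT _).
case: (boolP (indep i j)) => [/indepP[Bi Bj Bij]|_ /=].
  by rewrite integral_centeredM_eq0.
apply: le_trans (ler_norm _) _; apply: le_trans (le_normr_Rintegral _ _) _ => //.
have -> : 1 = \int[mu]_(x in setT) (cst 1 x) :> R.
  by rewrite Rintegral_const.
apply: le_Rintegral => //.
- apply: (@bounded_integrable _ 1); last by move=> x; rewrite normr_id.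
  by apply: measurableT_comp => //; apply: measurable_funM; exact: measurable_centered.
- by apply: (@bounded_integrable _ 1) => // x; rewrite normr1.
Qed.

(* Along fourth powers the variances of the means are summable; in between the
   partial counts move by at most one per step. *)
Lemma ae_cvg_mean (indep : rel nat) (C : nat) :
    (forall i j, indep i j -> [/\ mu (B i) = q%:E, mu (B j) = q%:E &
                               mu (B i `&` B j) = (q ^+ 2)%:E]) ->
    (forall n, (\sum_(i < n.+1 ^ 4) \sum_(j < n.+1 ^ 4) ~~ indep i j <=
                C * n.+1 ^ 6)%N) ->
  {ae mu, forall x, (count (fun i => x \in B i) (iota 0 n))%:R / n%:R
                      @[n --> \oo] --> q}.
Proof.
move=> indepP dep.
pose f n x := (\sum_(i < n.+1 ^ 4) centered i x) ^+ 2 / (n.+1 ^ 4)%N%:R ^+ 2.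
have ms n : measurable_fun setT (fun x => \sum_(i < n) centered i x).
  apply: measurable_sum => i; exact: measurable_centered.
suff : {ae mu, forall x, f n x @[n --> \oo] --> 0}.
  apply: filterS => x fx; apply: cvg_mean_of_fourth_powers => //.
    move=> n; rewrite -[in iota 0 n.+1]addn1 iotaD count_cat /= add0n addn0.
    by case: (_ \in _); lia.
  rewrite (_ : (fun n => _) = f ^~ x) //; apply/funext => n; rewrite /f.
  have N0 : (n.+1 ^ 4)%N%:R != 0 :> R by rewrite pnatr_eq0 expn_eq0.
  rewrite -expr_div_n; congr (_ ^+ 2); apply: (mulIf N0).
  rewrite mulrBl !divfK // /centered sumrB sumr_const card_ord mulr_natr.
  congr (_ - _); rewrite -sum1_count natr_sum big_mkcond /= -(big_mkord xpredT
    (fun i => \1_(B i) x)) /index_iota subn0; apply: eq_bigr => i _.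
  by rewrite indicE; case: (_ \in _).
apply: (@ae_cvg0_of_integral_bound _ _ _ _ _ C%:R).
- by move=> n; apply: measurable_funM => //; exact: measurable_funX.
- by move=> n x; rewrite /f divr_ge0 // sqr_ge0.
move=> n; set N := (n.+1 ^ 4)%N.
have -> : (fun x => (f n x)%:E) = (fun x =>
    ((N%:R ^+ 2)^-1)%:E * ((\sum_(i < N) centered i x) ^+ 2)%:E)%E.
  by apply/funext => x; rewrite /f mulrC EFinM.
have mE : measurable_fun setT (fun x => ((\sum_(i < N) centered i x) ^+ 2)%:E).
  by apply/measurable_EFinP; exact: measurable_funX.
have N2 : 0 <= (N%:R ^+ 2)^-1 :> R by rewrite invr_ge0 sqr_ge0.
rewrite ge0_integralZl_EFin //; last by move=> x _; rewrite lee_fin sqr_ge0.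
apply: le_trans (lee_wpmul2l _ (second_moment_le N indepP)) _.
  by rewrite lee_fin invr_ge0 sqr_ge0.
rewrite -EFinM lee_fin; have := dep n; rewrite -/N -(ler_nat R) => H.
apply: le_trans (ler_wpM2l _ H) _; first by rewrite invr_ge0 sqr_ge0.
(* With N = (n + 1)^4, C (n + 1)^6 / N^2 is C / (n + 1)^2. *)
rewrite /N natrM !natrX; have : n.+1%:R != 0 :> R by [].
by move: n.+1%:R => y y0; rewrite le_eqVlt; apply/orP; left; apply/eqP; field.
Qed.

End second_moment.

(** * Cylinders under the uniform product measure *)

Section cylinders.
Variables (R : realType) (b : nat).
Hypothesis b_gt0 : (0 < b)%N.
Local Notation A := 'I_b.-1.+1.

Lemma measurable_cylinder (s : seq nat) (v : seq A) :
  measurable [set t : seqspace b | map t s = v].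
Proof.
elim: s v => [|x s IH] [|y v].
- by rewrite (_ : [set _ | _] = setT) //; apply/seteqP; split.
- by rewrite (_ : [set _ | _] = set0) //; apply/seteqP; split.
- by rewrite (_ : [set _ | _] = set0) //; apply/seteqP; split.
rewrite (_ : [set _ | _] = [set t : seqspace b | t x \in [set y]%SET] `&`
    [set t : seqspace b | map t s = v]).
  by apply: measurableI => //; apply: sub_sigma_algebra; exists x, [set y]%SET.
apply/seteqP; split => t /=; rewrite inE; first by move=> [-> ->].
by move=> [/eqP -> ->].
Qed.

(** A cylinder is a rectangle on an initial segment: a singleton, of weight 1/b, at each position in
    s and the whole alphabet, of weight 1, elsewhere. *)
Lemma uniform_product_cylinder (lambda : probability (seqspace b) R)
    (s : seq nat) (v : seq A) :
    uniform_product lambda -> uniq s -> size s = size v ->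
  lambda [set t : seqspace b | map t s = v] = (b%:R ^- size s)%:E.
Proof.
move=> lambdaP us sv.
pose E i : {set A} :=
  if i \in s then [set nth ord0 v (index i s)]%SET else [set: A]%SET.
pose n := (\max_(i <- s) i).+1.
have sn i : i \in s -> (i < n)%N.
  by move=> si; rewrite ltnS (leq_bigmax_seq (F := id)).
rewrite (_ : [set _ | _] = [set t | forall i, (i < n)%N -> t i \in E i]); last first.
  apply/seteqP; split => t /=.
    move=> tv i _; rewrite /E; case: ifPn => si; last by rewrite inE.
    by rewrite inE -tv (nth_map 0%N) ?index_mem // nth_index.
  move=> tE; apply: (@eq_from_nth _ ord0); first by rewrite size_map.
  move=> l; rewrite size_map => ls; rewrite (nth_map 0%N) //.
  have sl : nth 0%N s l \in s by exact: mem_nth.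
  by have := tE _ (sn _ sl); rewrite /E sl inE index_uniq // => /eqP.
rewrite lambdaP; congr EFin.
have b0 : b%:R != 0 :> R by rewrite pnatr_eq0 -lt0n.
rewrite (eq_bigr (fun i : 'I_n => if val i \in s then b%:R^-1 else 1)); last first.
  move=> i _; rewrite /E; case: ifP => _; first by rewrite cards1 mul1r.
  by rewrite cardsT card_ord prednK // divff.
rewrite -(big_mkord xpredT (fun i => if i \in s then b%:R^-1 else 1)).
rewrite -big_mkcond /= -big_filter big_const_seq count_predT iter_mulr_1 exprVn.
congr (_ ^- _); apply/perm_size/uniq_perm => //.
  by rewrite filter_uniq // iota_uniq.
move=> i; rewrite mem_filter mem_index_iota /=.
by case: (boolP (i \in s)) => //= /sn.
Qed.

End cylinders.

(** * Block frequencies of random Toeplitz sequences *)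

Lemma ae_block_freq (R : realType) (b : nat) (P : seq nat)
    (lambda : probability (seqspace b) R) (k d : nat) :
    (2 <= b)%N -> all prime P -> uniform_product lambda ->
    (0 < k)%N -> (d < b ^ k)%N ->
  {ae distribution lambda (@toeplitz b P), forall t : seqspace b,
    block_freq R t k d n @[n --> \oo] --> ((b ^ k)%N%:R^-1 : R)}.
Proof.
move=> b_ge2 pP lambdaP k0 dk.
have [w wd] := word_val_surj b_ge2 dk; have b_gt0 := ltnW b_ge2.
pose mu : probability (seqspace b) R := distribution lambda (@toeplitz b P).
pose B i := [set t : seqspace b | map t (block k i) = mkseq w k].
have mB i : measurable (B i) by exact: measurable_cylinder.
have BE t i : (t \in B i) = (block_val t k i == d).
  apply/idP/eqP; rewrite -wd inE /B /=.
    move=> tw; apply/word_val_inj => // l lk; have := congr1 (nth ord0 ^~ l) tw.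
    by rewrite (nth_map 0%N) ?size_iota // nth_iota // nth_mkseq.
  move=> /word_val_inj tw; apply: (@eq_from_nth _ ord0).
    by rewrite size_map size_iota size_mkseq.
  move=> l; rewrite size_map size_iota => lk.
  by rewrite (nth_map 0%N) ?size_iota // nth_iota // nth_mkseq // tw.
(* The preimage of such a cylinder under the transform is the cylinder over the sources of its
   positions. *)
have muC s v : uniq (map (source P) s) -> size s = size v ->
    mu [set t : seqspace b | map t s = v] = (b%:R ^- size s)%:E.
  move=> us sv; rewrite -(size_map (source P) s).
  rewrite -(uniform_product_cylinder (v := v) b_gt0 lambdaP us) ?size_map //.
  rewrite /mu /= /distribution /pushforward; congr (lambda _).
  by apply/seteqP; split => a /=; rewrite -map_comp.
pose q : R := (b ^ k)%N%:R^-1.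
have q01 : 0 <= q <= 1.
  rewrite invr_ge0 ler0n invf_le1 ?ltr0n ?expn_gt0 ?b_gt0 //.
  by rewrite ler1n expn_gt0 b_gt0.
have [C0 HC0] := size_smooths_pow4 P k0.
have ind i j : independent_blocks P k i j -> [/\ mu (B i) = q%:E,
    mu (B j) = q%:E & mu (B i `&` B j) = (q ^+ 2)%:E].
  move=> ij; have := ij; rewrite /independent_blocks map_cat cat_uniq.
  move=> /and3P[ui _ uj].
  have qE : q = b%:R ^- k by rewrite /q natrX.
  split; rewrite ?qE; try by rewrite muC ?size_mkseq ?size_iota.
  rewrite (_ : _ `&` _ = [set t : seqspace b |
      map t (block k i ++ block k j) = mkseq w k ++ mkseq w k]).
    rewrite muC ?size_cat ?size_iota ?size_mkseq //.
    by rewrite exprVn -exprM muln2 addnn.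
  apply/seteqP; split => t /=; first by rewrite map_cat => -[-> ->].
  move/eqP; rewrite map_cat eqseq_cat ?size_map ?size_iota ?size_mkseq //.
  by move=> /andP[/eqP ? /eqP ?].
(* Order N = (n + 1)^4 positions times order (n + 1)^2 smooth numbers. *)
have dep n : (\sum_(i < n.+1 ^ 4) \sum_(j < n.+1 ^ 4)
    ~~ independent_blocks P k i j <= 3 * k * C0 * n.+1 ^ 6)%N.
  apply: leq_trans (count_dependent_blocks k _ pP) _.
  apply: (@leq_trans (3 * (k * n.+1 ^ 4) * (C0 * n.+1 ^ 2))%N).
    by rewrite leq_mul2l HC0 ?orbT.
  by rewrite (expnD _ 4 2); apply/eq_leq; ring.
apply: filterS (ae_cvg_mean mB q01 ind dep) => t.
rewrite (_ : (fun n => _) = block_freq R t k d) //.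
by apply/funext => n; congr (_%:R / _); apply: eq_count => i; exact: BE.
Qed.

Theorem theorem1 (R : realType) (b : nat) (b_ge2 : (2 <= b)%N)
    (P : seq nat) (P_gt0 : (0 < size P)%N) (P_uniq : uniq P)
    (P_prime : all prime P)
    (lambda : probability (seqspace b) R) (lambda_prod : uniform_product lambda) :
  {ae pushforward lambda (@toeplitz b P), forall t : seqspace b,
     toeplitz_set P t -> exists x : R, expansion_of t x /\ normal b x}.
Proof.
have H : {ae distribution lambda (@toeplitz b P), forall t : seqspace b,
    forall k d, (0 < k)%N -> (d < b ^ k)%N ->
    block_freq R t k d n @[n --> \oo] --> ((b ^ k)%N%:R^-1 : R)}.
  (* There are countably many pairs (k, d), so the exceptional null sets unite to a null set; pairs
     out of range hold vacuously. *)
  apply: ae_foralln => k; apply: ae_foralln => d.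
  have [kd|kd] := boolP ((0 < k)%N && (d < b ^ k)%N); last first.
    by apply: nearW => t k0 dk; case/negP: kd; rewrite k0.
  have /andP[k0 dk] := kd.
  by apply: filterS (ae_block_freq b_ge2 P_prime lambda_prod k0 dk) => t.
by apply: filterS H => t tfr _; exact: normal_of_block_freq.
Qed.
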